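(* Let $m,n\in\mathbb{N}$. Then $$(-1)^m\sum_{\substack{(y_1,\ldots,y_m)\\ \sum i y_i=m}}\prod_{i=1}^{m}\frac{(-1)^{y_i}}{y_i!}\left(\frac{n}{i}\right)^{y_i}=\binom{n}{m},$$ where the sum runs over all partitions of $m$.
   Context: $\mathbb{N}=\{0,1,2,\ldots\}$. A partition of $m$ is represented by the tuple $(y_1,\ldots,y_m)$ of non-negative integers with $\sum_{i=1}^m i\,y_i=m$. For $m=0$ there is exactly one partition, the empty one. Empty products equal $1$, $0^0=1$, and $\binom{n}{m}=0$ for $n<m$. *)

(* Defs.v *)
From mathcomp Require Import all_boot all_order all_algebra.

Set Implicit Arguments.
Unset Strict Implicit.
Unset Printing Implicit Defensive.

(* Partitions of m in multiplicity form: the part i.+1 occurs [tnth y i] times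
   (indices start at 0).  Every multiplicity is at most m, so restricting the
   entries to 'I_m.+1 only serves to make the type finite: see
   [intpartnsP]. *)
Definition intpartns (m : nat) : {set m.-tuple 'I_m.+1} :=
  [set y : m.-tuple 'I_m.+1 | \sum_(i < m) i.+1 * tnth y i == m].

Lemma intpartnsP (m : nat) (y : m.-tuple nat) :
  \sum_(i < m) i.+1 * tnth y i = m <->
  exists2 z : m.-tuple 'I_m.+1, z \in intpartns m & y = map_tuple val z.
Proof.
split=> [ym | [z]]; last first.
  rewrite inE => /eqP zm ->; rewrite -[RHS]zm.
  by apply: eq_bigr => i _; rewrite tnth_map.
have yle (i : 'I_m) : tnth y i < m.+1.
  rewrite ltnS -[leqRHS]ym (bigD1 i) //= mulSn -addnA.
  exact: leq_addr.
exists [tuple Ordinal (yle i) | i < m].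
  rewrite inE; apply/eqP; rewrite -[RHS]ym.
  by apply: eq_bigr => i _; rewrite tnth_mktuple.
by apply: eq_from_tnth => i; rewrite tnth_map tnth_mktuple.
Qed.

(* Main.v *)
Require Import Defs.
From mathcomp Require Import all_boot all_order all_algebra.
From mathcomp Require Import ring.
Import GRing.Theory Num.Theory.
Local Open Scope ring_scope.

(** The sum is a coefficient of a generating function.  Expanding
    exponentials, the sum over the partitions of m of the products of
    (x / i)^(y_i) / y_i! is the coefficient of T^m in
      prod_i exp (x T^i / i) = exp (x * sum_i T^i / i) = (1 - T)^(-x),
    hence it equals x (x + 1) ... (x + m - 1) / m!; at x = - n this is
    (-1)^m times the binomial coefficient.

    Polynomials suffice for this, with derivatives compared modulo T^m.  The
    exponential series are cut after their term of index m, and the factors are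
    those with i <= m, which changes no coefficient of degree at most m; the
    product P of these truncations has the partition sum as its coefficient of
    T^m ([coef_prod_truncexp]).  The closed
    form follows from a differential equation instead of from logarithms: each
    truncated exponential satisfies E' = x T^(i-1) E modulo T^m
    ([truncexp_logderiv]), logarithmic derivatives add up under products
    ([dvdp_logderiv_prod]), and the geometric sum turns the result into
    (1 - T) P' = x P modulo T^m.  Comparing coefficients gives
    (k + 1) P_(k+1) = (x + k) P_k for k < m ([coef_geometric_logderiv]). *)

(** The Leibniz rule: the logarithmic derivatives G i of the factors, known
    modulo d, add up.  Writing E' = G E instead of E' / E = G keeps the
    statement within polynomials. *)
Lemma dvdp_logderiv_prod {R : idomainType} {I : Type} (r : seq I)
    (d : {poly R}) (E G : I -> {poly R}) :
  (forall i, d %| (E i)^`() - G i * E i) ->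
  d %| (\prod_(i <- r) E i)^`() - (\sum_(i <- r) G i) * \prod_(i <- r) E i.
Proof.
move=> dE; elim: r => [|i r IHr].
  by rewrite !big_nil derivC mul0r subrr dvdp0.
rewrite !big_cons derivM.
set P := \prod_(j <- r) E j in IHr *; set S := \sum_(j <- r) G j in IHr *.
have -> : (E i)^`() * P + E i * P^`() - (G i + S) * (E i * P)
          = ((E i)^`() - G i * E i) * P + E i * (P^`() - S * P) by ring.
by apply: dvdp_add; [apply: dvdp_mulr | apply: dvdp_mull].
Qed.

(** If p' = x (1 + T + ... + T^(m-1)) p modulo T^m, then multiplying by 1 - T
    leaves (1 - T) p' = x p modulo T^m, a two-term recurrence. *)
Lemma coef_geometric_logderiv {F : fieldType} (x : F) (m : nat)
    (p : {poly F}) :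
  'X^m %| p^`() - (\sum_(i < m) x *: 'X^i) * p ->
  forall k, (k < m)%N -> k.+1%:R * p`_k.+1 = (x + k%:R) * p`_k.
Proof.
move=> dvd_p k ltkm.
have /dvdpP [q def_q] : 'X^m %| (1 - 'X) * p^`() - x *: p.
  have -> : (1 - 'X) * p^`() - x *: p
      = (1 - 'X) * (p^`() - (\sum_(i < m) x *: 'X^i) * p) - (x *: p) * 'X^m.
    rewrite -scaler_sumr -!mul_polyC.
    have geom : 'X^m - 1 = ('X - 1) * \sum_(i < m) 'X^i :> {poly F}.
      exact: subrX1.
    have -> : 'X^m = 1 + ('X - 1) * \sum_(i < m) 'X^i :> {poly F}.
      by rewrite -geom addrC subrK.
    by ring.
  by apply: dvdp_sub; [apply: dvdp_mull | apply: dvdp_mull].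
have := congr1 (fun r : {poly F} => r`_k) def_q.
rewrite coefMXn ltkm mulrBl mul1r !coefB coefZ coef_deriv coefXM => /eqP.
case: k ltkm => [|k] _ /=; rewrite ?coef_deriv -?[p`_ _ *+ _]mulr_natl.
  by rewrite subr0 addr0 subr_eq0 => /eqP.
by rewrite -addrA -opprD -mulrDl subr_eq0 [in X in _ == X]addrC => /eqP.
Qed.

(** The exponential of x T^(i+1) / (i+1), cut after the term of index m
    of the exponential series. *)
Definition truncexp {F : fieldType} (x : F) (m i : nat) : {poly F} :=
  \sum_(k < m.+1) ((x / i.+1%:R) ^+ k / (k`!)%:R) *: 'X^(i.+1 * k).

(** Differentiation shifts the exponential series, so E' and x T^i E differ
    only by the last term of the latter, of degree i + (i + 1) m. *)
Lemma truncexp_logderiv {F : numFieldType} (x : F) (m i : nat) :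
  'X^m %| (truncexp x m i)^`() - (x *: 'X^i) * truncexp x m i.
Proof.
rewrite /truncexp [X in X^`()]big_ord_recl derivD.
rewrite [X in _ - _ * X]big_ord_recr /=.
rewrite muln0 derivZ derivC scaler0 add0r mulrDr opprD addrA.
have -> : (\sum_(k < m) ((x / i.+1%:R) ^+ bump 0 k / ((bump 0 k)`!)%:R)
               *: 'X^(i.+1 * bump 0 k))^`()
          = (x *: 'X^i)
            * \sum_(k < m) ((x / i.+1%:R) ^+ k / (k`!)%:R) *: 'X^(i.+1 * k).
  rewrite raddf_sum mulr_sumr; apply: eq_bigr => k _.
  rewrite /bump /= add1n derivZ derivXn -scalerAl -scalerAr scalerA -exprD.
  rewrite mulnS addSn /= -scaler_nat scalerA; congr (_ *: _).
  rewrite factS natrM exprS.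
  have -> : (i + i.+1 * k).+1 = (i.+1 * k.+1)%N by rewrite mulnS addSn.
  rewrite natrM; field.
  by rewrite !nat1r !pnatr_eq0 -lt0n fact_gt0.
rewrite subrr sub0r dvdpNr -scalerAl -scalerAr scalerA -exprD.
rewrite -mul_polyC; apply/dvdp_mull/dvdp_exp2l.
by rewrite mulSn addnCA leq_addr.
Qed.

(** Distributing the product chooses a term y_i of each exponential; the terms
    of degree m are the partitions of m. *)
Lemma coef_prod_truncexp {F : fieldType} (x : F) (m : nat) :
  (\prod_(i < m) truncexp x m i)`_m
  = \sum_(y in intpartns m)
      \prod_(i < m) ((x / i.+1%:R) ^+ tnth y i / ((tnth y i)`!)%:R).
Proof.
rewrite bigA_distr_bigA /= coef_sum (reindex finfun_of_tuple) /=; last first.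
  by exists tuple_of_finfun => y _; rewrite ?tuple_of_finfunK ?finfun_of_tupleK.
rewrite [RHS]big_mkcond /=; apply: eq_bigr => y _.
rewrite scaler_prod prodrXr coefZ coefXn inE.
under eq_bigr do rewrite ffunE.
under [in X in _ * (_ == X)%:R]eq_bigr do rewrite ffunE.
by rewrite eq_sym; case: eqP => _; rewrite ?mulr1 ?mulr0.
Qed.

(** The coefficient of T^m in (1 - T)^(-x). *)
Lemma sum_intpartns_exp {F : numFieldType} (x : F) (m : nat) :
  \sum_(y in intpartns m)
     \prod_(i < m) ((x / i.+1%:R) ^+ tnth y i / ((tnth y i)`!)%:R)
  = (\prod_(j < m) (x + j%:R)) / (m`!)%:R.
Proof.
rewrite -coef_prod_truncexp; set p := \prod_(i < m) _.
have rec k : (k < m)%N -> k.+1%:R * p`_k.+1 = (x + k%:R) * p`_k.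
  apply: coef_geometric_logderiv; apply: dvdp_logderiv_prod => i.
  exact: truncexp_logderiv.
have p0 : p`_0 = 1.
  rewrite -horner_coef0 horner_prod big1 // => i _.
  rewrite /truncexp horner_sum big_ord_recl /= big1 => [|k _].
    by rewrite muln0 hornerZ hornerXn expr0 fact0 divr1 mulr1 addr0.
  by rewrite hornerZ hornerXn /bump mulnDr muln1 addSn exprS mul0r mulr0.
suff closed k : (k <= m)%N -> p`_k = (\prod_(j < k) (x + j%:R)) / (k`!)%:R.
  exact: closed.
elim: k => [_|k IHk ltkm]; first by rewrite big_ord0 fact0 divr1.
have k1_neq0 : k.+1%:R != 0 :> F by rewrite pnatr_eq0.
apply: (mulfI k1_neq0); rewrite rec // IHk 1?ltnW // big_ord_recr /=.
rewrite factS natrM; field.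
by rewrite !nat1r !pnatr_eq0 -lt0n fact_gt0.
Qed.

Lemma prod_subn_bin {F : numFieldType} (m n : nat) :
  (\prod_(j < m) (- n%:R + j%:R)) / (m`!)%:R = (-1) ^+ m * 'C(n, m)%:R :> F.
Proof.
elim: m => [|m IHm]; first by rewrite big_ord0 fact0 divr1 bin0 mulr1.
have m1_neq0 : m.+1%:R != 0 :> F by rewrite pnatr_eq0.
have fact_neq0 : (m`!)%:R != 0 :> F by rewrite pnatr_eq0 -lt0n fact_gt0.
apply: (mulfI m1_neq0).
have -> : m.+1%:R * ((-1) ^+ m.+1 * 'C(n, m.+1)%:R)
          = - (-1) ^+ m * (m.+1 * 'C(n, m.+1))%:R :> F.
  by rewrite natrM exprS; ring.
rewrite mul_bin_left natrM big_ord_recr /= factS natrM.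
have -> : (n - m)%:R * 'C(n, m)%:R = (n%:R - m%:R) * 'C(n, m)%:R :> F.
  (* For n < m the truncated difference is wrong, but the binomial vanishes. *)
  case: (leqP m n) => [lemn | ltnm]; first by rewrite natrB.
  by rewrite bin_small // !mulr0.
transitivity ((m%:R - n%:R) * ((-1) ^+ m * 'C(n, m)%:R) : F); last by ring.
rewrite -IHm; field.
by rewrite fact_neq0 nat1r.
Qed.

Theorem corollary3p2 (m n : nat) :
  (-1) ^+ m *
    (\sum_(y in intpartns m)
       \prod_(i < m)
         ((-1) ^+ tnth y i / ((tnth y i)`!)%:R
            * (n%:R / i.+1%:R) ^+ tnth y i))
  = 'C(n, m)%:R :> rat.
Proof.
transitivity ((-1) ^+ m * ((-1) ^+ m * 'C(n, m)%:R) : rat); last first.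
  by rewrite mulrA -expr2 sqrr_sign mul1r.
rewrite -prod_subn_bin -sum_intpartns_exp; congr (_ * _).
apply: eq_bigr => y _; apply: eq_bigr => i _.
by rewrite mulrAC -exprMn mulrA mulN1r.
Qed.
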